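(* Let $M=(M_p)_{p\in\mathbb{N}}\in\mathcal{LC}$ be given and put $m_p:=M_p/p!$. Then $\omega_M$ satisfies $(\alpha_1)$, i.e. $$\exists\,C\ge 1\;\forall\,\lambda\ge 1\;\exists\,D_\lambda\ge 1\;\forall\,t\ge 0:\quad \omega_M(\lambda t)\le C\lambda\,\omega_M(t)+D_\lambda\lambda,$$ if and only if some (equivalently, each) of the following mutually equivalent conditions holds: (i) $\exists\,A\ge 1\;\exists\,B\ge 1\;\exists\,C\ge 1\;\forall\,\lambda\ge 1\;\exists\,D\ge 1\;\forall\,t\ge 0:\quad \omega_M(\lambda Ct)\le B\lambda\,\omega_M(At)+D\lambda.$ (ii) $\exists\,C\in\mathbb{N}_{>0}\;\exists\,B\ge 1\;\forall\,\lambda\in\mathbb{N}_{>0}\;\exists\,D\ge 1\;\forall\,p\in\mathbb{N}_{>0}:\quad \lambda\,(M_p)^{1/p}\le B D^{1/p}\,(M_{\lambda Cp})^{1/(\lambda Cp)}.$ (iii) $\exists\,C\in\mathbb{N}_{>0}\;\exists\,A\ge 1\;\forall\,\lambda\in\mathbb{N}_{>0}\;\exists\,D\ge 1\;\forall\,p\in\mathbb{N}_{>0}:\quad (m_p)^{1/p}\le A D^{1/p}\,(m_{\lambda Cp})^{1/(\lambda Cp)}.$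
   Context: Notation: $\mathbb{N}=\{0,1,2,\dots\}$, $\mathbb{N}_{>0}=\{1,2,3,\dots\}$. $\mathcal{LC}$ denotes the set of all sequences $M=(M_p)_{p\in\mathbb{N}}$ of positive reals that are normalized ($1=M_0\le M_1$), log-convex ($M_p^2\le M_{p-1}M_{p+1}$ for all $p\ge 1$) and satisfy $\lim_{p\to+\infty}(M_p)^{1/p}=+\infty$. The associated weight function of $M$ is $\omega_M:[0,+\infty)\to[0,+\infty)$, $\omega_M(t):=\sup_{p\in\mathbb{N}}\log\left(\frac{t^p}{M_p}\right)$ for $t>0$, $\omega_M(0):=0$. *)

(* Defs.v *)
From HB Require Import structures.
From mathcomp Require Import all_boot all_order all_algebra.
From mathcomp Require Import all_classical all_reals all_analysis.

Set Implicit Arguments.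
Unset Strict Implicit.
Unset Printing Implicit Defensive.

Import Order.TTheory GRing.Theory Num.Theory.
Import numFieldNormedType.Exports.

Local Open Scope classical_set_scope.
Local Open Scope ring_scope.

(* The value of the root at p = 0, where p%:R^-1 = 0, is irrelevant to the
   limit. *)
Definition LC (R : realType) (M : nat -> R) : Prop :=
  [/\ forall p, 0 < M p,
      M 0%N = 1 /\ 1 <= M 1%N,
      forall p, (1 <= p)%N -> M p ^+ 2 <= M p.-1 * M p.+1
    & M p `^ (p%:R^-1) @[p --> \oo] --> +oo].

(* The supremum is taken in R: for M in LC the set is nonempty and bounded
   above, so that [sup] is the genuine least upper bound. *)
Definition omega (R : realType) (M : nat -> R) (t : R) : R :=
  if 0 < t then sup [set ln (t ^+ p / M p) | p in [set: nat]] else 0.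

Definition alpha1 (R : realType) (w : R -> R) : Prop :=
  exists2 C : R, 1 <= C &
    forall lambda : R, 1 <= lambda ->
      exists2 D : R, 1 <= D &
        forall t : R, 0 <= t ->
          w (lambda * t) <= C * lambda * w t + D * lambda.

(* Main.v *)
(* Put [a p = ln (M p)], a convex nondecreasing sequence with [a 0 = 0], so that
   [omega M (expR s)] is the supremum of [p s - a p]. If (alpha1) holds, with
   [C] a natural number, evaluate it at a slope [s] of [a] between [p] and
   [p + 1], where that supremum is attained at [p], and bound
   [omega M (l e^s)] from below by its term of index [l C p]: this is the
   logarithm of (ii). Conversely, write an index as [l C p + r] with
   [r < l C]; by monotonicity of [a], (ii) bounds the term of this index up to
   [r s], which costs one further multiple of [omega M (expR s)] since
   [s <= omega M (expR s) + a 1]. Finally (ii) and (iii) differ by the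
   Stirling-type bounds [p ln p - p <= ln p! <= p ln p], and (i) reduces to
   (alpha1) by rescaling [t] and [l]. *)
Require Import Defs.
From HB Require Import structures.
From mathcomp Require Import all_boot all_order all_algebra.
From mathcomp Require Import all_classical all_reals all_analysis.
From mathcomp Require Import ring lra zify.

Set Implicit Arguments.
Unset Strict Implicit.
Unset Printing Implicit Defensive.

Import Order.TTheory GRing.Theory Num.Theory.
Import numFieldNormedType.Exports.

Local Open Scope classical_set_scope.
Local Open Scope ring_scope.

(** * Convex sequences and Stirling-type bounds *)

(** The increments are nondecreasing, so all those between [p] and [q] compare with the one at [p];
    telescoping works on both sides of [p]. *)
Lemma convex_seq_support (R : realFieldType) (a : nat -> R) :
  (forall p, a p.+1 *+ 2 <= a p + a p.+2) ->
  forall p q, a p + (q%:R - p%:R) * (a p.+1 - a p) <= a q.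
Proof.
move=> conv.
have incr : {homo (fun p => a p.+1 - a p) : p q / (p <= q)%N >-> p <= q}.
  apply/nondecreasing_seqP => p; have := conv p; rewrite mulr2n; lra.
move=> p q; have [le_pq|/ltnW le_qp] := leqP p q.
- rewrite -(subnKC le_pq); elim: (q - p)%N => [|k IHk].
    by rewrite addn0 subrr mul0r addr0.
  rewrite addnS -[(p + k).+1%:R]natr1.
  by have := incr p (p + k)%N (leq_addr _ _); lra.
- rewrite -(subnKC le_qp); move: (p - q)%N => k {le_qp}.
  elim: k q => [|k IHk] q; first by rewrite addn0 subrr mul0r addr0.
  have := IHk q.+1; rewrite addSnnS -[q.+1%:R]natr1.
  by have := incr q (q + k.+1)%N (leq_addr _ _); lra.
Qed.

Lemma ln_fact_bounds (R : realType) (p : nat) : (0 < p)%N ->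
  ln p%:R - 1 <= ln (p`!%:R : R) / p%:R <= ln p%:R.
Proof.
move=> p0; have p0R : 0 < p%:R :> R by rewrite ltr0n.
have f0 : 0 < p`!%:R :> R by rewrite ltr0n fact_gt0.
rewrite ler_pdivlMr// ler_pdivrMr//; apply/andP; split.
(* A single term of the exponential series at [p] is at most its sum. *)
- have : p%:R ^+ p / p`!%:R <= expR p%:R :> R.
    have := @expR_ge1Dxn R p%:R p.-1 (ltW p0R); rewrite prednK//; lra.
  rewrite -ler_ln ?posrE ?expR_gt0 ?divr_gt0 ?exprn_gt0// expRK.
  by rewrite ln_div ?posrE ?exprn_gt0// lnXn// -mulr_natr; lra.
- rewrite mulr_natr -lnXn// ler_ln ?posrE ?exprn_gt0// -natrX ler_nat.
  (* The base stays fixed: [k! <= p ^ k] for all [k <= p]. *)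
  elim: {1 3 5}p (leqnn p) => [|k IHk] kp //.
  by rewrite factS expnS leq_mul// IHk// ltnW.
Qed.

(** * Logarithmic forms of (ii) and (iii) *)

Lemma ler_mul_powR_ln (R : realType) (l x B D y : R) (p q : nat) :
  0 < l -> 0 < x -> 0 < B -> 0 < D -> 0 < y ->
  (l * x `^ p%:R^-1 <= B * D `^ p%:R^-1 * y `^ q%:R^-1) =
  (ln l + ln x / p%:R <= ln B + ln D / p%:R + ln y / q%:R).
Proof.
move=> l0 x0 B0 D0 y0.
rewrite -ler_ln ?posrE ?mulr_gt0 ?powR_gt0//.
rewrite !lnM ?posrE ?mulr_gt0 ?powR_gt0// !ln_powR.
by rewrite ![_^-1 * _]mulrC.
Qed.

(* The logarithm of condition (ii) for [c l = l] and [x = M], and of condition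
   (iii) for [c l = 1] and [x = m]; [b] and [d] are the logarithms of the outer
   constant and of [D]. *)
Definition log_growth (R : realType) (c x : nat -> R) (C : nat) (b : R) : Prop :=
  forall l : nat, (0 < l)%N ->
    exists2 d : R, 0 <= d &
      forall p : nat, (0 < p)%N ->
        ln (c l) + ln (x p) / p%:R
          <= b + d / p%:R + ln (x (l * C * p)%N) / (l * C * p)%:R.

Lemma log_growthP (R : realType) (c x : nat -> R) :
  (forall l, (0 < l)%N -> 0 < c l) -> (forall p, 0 < x p) ->
  (exists (C : nat) (B : R), [/\ (0 < C)%N, 1 <= B &
     forall l : nat, (0 < l)%N ->
       exists2 D : R, 1 <= D &
         forall p : nat, (0 < p)%N ->
           c l * x p `^ (p%:R^-1)
             <= B * D `^ (p%:R^-1) * x (l * C * p)%N `^ ((l * C * p)%:R^-1)]) <->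
  (exists (C : nat) (b : R), [/\ (0 < C)%N, 0 <= b & log_growth c x C b]).
Proof.
move=> c0 x0; split=> -[C [B [C0 B1 H]]].
- exists C, (ln B); split=> // [|l l0]; first exact: ln_ge0.
  have [D D1 HD] := H l l0; exists (ln D); first exact: ln_ge0.
  move=> p p0; have := HD p p0.
  by rewrite ler_mul_powR_ln ?c0// (lt_le_trans ltr01).
- exists C, (expR B); split=> // [|l l0]; first by rewrite -expR0 ler_expR.
  have [D D1 HD] := H l l0; exists (expR D); first by rewrite -expR0 ler_expR.
  move=> p p0; rewrite ler_mul_powR_ln ?c0 ?expR_gt0// !expRK.
  exact: HD.
Qed.

(** Dividing by factorials subtracts about [ln p] on the left and [ln (l C p)] on the right. The
    difference [ln l] is the factor [l] of (ii); [ln C] and the Stirling error 1 go into the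
    constant. *)
Lemma log_growth_div_fact (R : realType) (M : nat -> R) (C : nat) (b : R) :
  (0 < C)%N -> (forall p, 0 < M p) ->
  log_growth (fun l => l%:R) M C b ->
  log_growth (fun=> 1) (fun p => M p / p`!%:R) C (b + (ln C%:R + 1)).
Proof.
move=> C0 M0 H l l0; have [d d0 Hd] := H l l0; exists d => // p p0.
have f0 q : 0 < q`!%:R :> R by rewrite ltr0n fact_gt0.
rewrite ln1 add0r !ln_div ?posrE// !mulrBl; have := Hd p p0.
have N0 : (0 < l * C * p)%N by rewrite !muln_gt0 l0 C0.
have /andP[_] := ln_fact_bounds R N0; have /andP[+ _] := ln_fact_bounds R p0.
have -> : ln (l * C * p)%:R = ln l%:R + ln C%:R + ln p%:R :> R.
  by rewrite !natrM !lnM ?posrE ?mulr_gt0 ?ltr0n.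
lra.
Qed.

Lemma div_fact_log_growth (R : realType) (M : nat -> R) (C : nat) (b : R) :
  (0 < C)%N -> (forall p, 0 < M p) ->
  log_growth (fun=> 1) (fun p => M p / p`!%:R) C b ->
  log_growth (fun l => l%:R) M C (b + 1).
Proof.
move=> C0 M0 H l l0; have [d d0 Hd] := H l l0; exists d => // p p0.
have f0 q : 0 < q`!%:R :> R by rewrite ltr0n fact_gt0.
have := Hd p p0; rewrite ln1 add0r !ln_div ?posrE// !mulrBl.
have N0 : (0 < l * C * p)%N by rewrite !muln_gt0 l0 C0.
have /andP[+ _] := ln_fact_bounds R N0; have /andP[_] := ln_fact_bounds R p0.
have -> : ln (l * C * p)%:R = ln l%:R + ln C%:R + ln p%:R :> R.
  by rewrite !natrM !lnM ?posrE ?mulr_gt0 ?ltr0n.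
(* In this direction [ln C] has the favourable sign and is dropped. *)
have : 0 <= ln C%:R :> R by rewrite ln_ge0// ler1n.
lra.
Qed.

(** * The weight function of a log-convex sequence *)

Section AssociatedWeight.
Variables (R : realType) (M : nat -> R).
Hypothesis hM : LC M.

Let M_gt0 p : 0 < M p. Proof. by case: hM. Qed.

Lemma LC_ln_convex p : ln (M p.+1) *+ 2 <= ln (M p) + ln (M p.+2).
Proof.
have [_ _ lc _] := hM.
rewrite -lnXn// -lnM ?posrE// ler_ln ?posrE ?exprn_gt0 ?mulr_gt0//.
exact: (lc p.+1).
Qed.

Lemma LC_ln0 : ln (M 0%N) = 0.
Proof. by have [_ [-> _] _ _] := hM; rewrite ln1. Qed.

Lemma LC_ln_nondecreasing : {homo (fun p => ln (M p)) : p q / (p <= q)%N >-> p <= q}.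
Proof.
have a1 : 0 <= ln (M 1%N) by have [_ [_ ?] _ _] := hM; rewrite ln_ge0.
apply/nondecreasing_seqP; elim=> [|p IHp]; first by rewrite LC_ln0.
by have := LC_ln_convex p; rewrite mulr2n; lra.
Qed.

Lemma LC_ln_ge0 p : 0 <= ln (M p).
Proof. by rewrite -LC_ln0 LC_ln_nondecreasing. Qed.

Let ln_term (t : R) p : 0 < t -> ln (t ^+ p / M p) = p%:R * ln t - ln (M p).
Proof. by move=> t0; rewrite ln_div ?posrE ?exprn_gt0// lnXn// mulr_natl. Qed.

Lemma omega_le (t x : R) : 0 < t ->
  (forall p, p%:R * ln t - ln (M p) <= x) -> omega M t <= x.
Proof.
move=> t0 H; rewrite /omega t0; apply: ge_sup.
  by exists (ln (t ^+ 0 / M 0)), 0%N.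
by move=> _ [p _ <-]; rewrite ln_term.
Qed.

Lemma omega_ge (t : R) (p : nat) : 0 < t -> p%:R * ln t - ln (M p) <= omega M t.
Proof.
move=> t0; rewrite /omega t0 -ln_term//; apply: ub_le_sup; last by exists p.
(* Boundedness of the set: beyond [P] the root of [M q] is at least [t], so the terms are at most 0;
   the others are at most [P * |ln t|]. *)
have [_ _ _ /cvgryPge/(_ t)[P _ HP]] := hM.
exists (P%:R * `|ln t|) => _ [q _ <-]; rewrite ln_term//.
have aq := LC_ln_ge0 q; have := ler_norm (ln t); have := normr_ge0 (ln t).
set n := `|ln t| => n0 tn.
have [qP|Pq] := leqP q P.
  have : q%:R * ln t <= q%:R * n by rewrite ler_wpM2l.
  have : q%:R * n <= P%:R * n by rewrite ler_wpM2r// ler_nat.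
  lra.
have q0 : 0 < q%:R :> R by rewrite ltr0n (leq_ltn_trans _ Pq).
have := HP q (ltnW Pq); rewrite /= -ler_ln ?posrE ?powR_gt0// ln_powR.
rewrite mulrC ler_pdivlMr// => H.
have : 0 <= P%:R * n by rewrite mulr_ge0.
lra.
Qed.

Lemma omega_ge0 (t : R) : 0 <= omega M t.
Proof.
have [t0|t0] := ltP 0 t; last by rewrite /omega ltNge t0.
by have := omega_ge 0 t0; rewrite LC_ln0; lra.
Qed.

Lemma omega_le1 (t : R) : t <= 1 -> omega M t = 0.
Proof.
move=> t1; apply/eqP; rewrite eq_le omega_ge0 andbT.
have [t0|t0] := ltP 0 t; last by rewrite /omega ltNge t0.
apply: omega_le => // p; have := LC_ln_ge0 p.
have : p%:R * ln t <= 0 by rewrite mulr_ge0_le0// ln_le0.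
lra.
Qed.

Lemma omega_nondecreasing : {homo omega M : s t / s <= t}.
Proof.
move=> s t st; have [s0|s0] := ltP 0 s; last first.
  by rewrite (omega_le1 (le_trans s0 ler01)) omega_ge0.
have t0 := lt_le_trans s0 st.
apply: omega_le => // p; apply: le_trans (omega_ge p t0).
by rewrite lerD2r ler_wpM2l// ler_ln.
Qed.

(* By convexity of [p |-> ln (M p)] the supremum is attained at [p] for
   [t = M p.+1 / M p]. *)
Lemma omega_attained (p : nat) :
  omega M (expR (ln (M p.+1) - ln (M p))) =
  p%:R * (ln (M p.+1) - ln (M p)) - ln (M p).
Proof.
apply/eqP; rewrite eq_le; apply/andP; split; last first.
  by have := omega_ge p (expR_gt0 (ln (M p.+1) - ln (M p))); rewrite expRK.
apply: omega_le => [|q]; first exact: expR_gt0.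
by rewrite expRK; have := convex_seq_support LC_ln_convex p q; lra.
Qed.

(** * From (alpha1) to (ii) *)

Lemma alpha1_log_growth : alpha1 (omega M) ->
  exists2 C : nat, (0 < C)%N & log_growth (fun l => l%:R) M C 0.
Proof.
move=> [C C1 H].
have [C' CC' C'0] : exists2 n : nat, C <= n%:R & (0 < n)%N.
  by exists (Num.truncn C).+1 => //; rewrite ltW// truncnS_gt.
exists C' => // l l0.
have l1 : 1 <= l%:R :> R by rewrite ler1n.
have [D D1 HD] := H _ l1.
(* After division by [N = l C' p], the error [D l <= D l C'] becomes at most [D / p]. *)
exists D; first lra.
move=> p p0; set N := (l * C' * p)%N.
have pR : 0 < p%:R :> R by rewrite ltr0n.
have CR : 0 < C'%:R :> R by rewrite ltr0n.
have lR : 0 < l%:R :> R by rewrite ltr0n.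
have NE : N%:R = l%:R * C'%:R * p%:R :> R by rewrite /N !natrM.
have NR : 0 < N%:R :> R by rewrite NE !mulr_gt0.
have := omega_attained p; set s := ln (M p.+1) - ln (M p) => phi_s.
have := HD _ (ltW (expR_gt0 s)).
have := @omega_ge (l%:R * expR s) N; rewrite mulr_gt0 ?expR_gt0// => /(_ isT).
rewrite lnM ?posrE ?expR_gt0// expRK.
set w := omega M (expR s) in phi_s *.
have w0 : 0 <= w by exact: omega_ge0.
have : C * l%:R * w <= C'%:R * l%:R * w by rewrite !ler_wpM2r.
have : D * l%:R <= D * l%:R * C'%:R.
  by rewrite ler_peMr ?ler1n// mulr_ge0//; lra.
rewrite phi_s => h1 h2 h3 h4.
(* The terms in [s] cancel, since [N s = l C' p s]. *)
have {h1 h2 h3 h4} : N%:R * ln l%:R + l%:R * C'%:R * ln (M p)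
    <= l%:R * C'%:R * D + ln (M N).
  by move: h2 h3; rewrite NE; lra.
move=> h; rewrite -(ler_pM2l NR).
have -> : N%:R * (ln l%:R + ln (M p) / p%:R) =
    N%:R * ln l%:R + l%:R * C'%:R * ln (M p).
  by rewrite NE; field; rewrite gt_eqF.
suff -> : N%:R * (0 + D / p%:R + ln (M N) / N%:R) = l%:R * C'%:R * D + ln (M N).
  by [].
rewrite add0r mulrDr [X in _ + X]mulrC divfK ?gt_eqF//; congr +%R.
by rewrite NE; field; rewrite gt_eqF.
Qed.

(** * From (ii) to (alpha1) *)

(** The shift by [b] cancels the outer constant of (ii). The factor 2 counts one share of the weight
    for the multiple of [l C] in the index and one for the remainder. *)
Lemma log_growth_omega_nat (C : nat) (b : R) : (0 < C)%N ->
  0 <= b -> log_growth (fun l => l%:R) M C b ->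
  forall l : nat, (0 < l)%N -> exists2 D : R, 0 <= D &
    forall s : R, omega M (l%:R * expR (s - b))
      <= C%:R * 2 * l%:R * omega M (expR s) + D * l%:R.
Proof.
move=> C0 b0 H l l0; have [d d0 Hd] := H _ l0.
have CR : 0 < C%:R :> R by rewrite ltr0n.
have lR : 0 < l%:R :> R by rewrite ltr0n.
have lnl : 0 <= ln l%:R :> R by rewrite ln_ge0// ler1n.
have a1 := LC_ln_ge0 1.
exists (C%:R * (d + ln (M 1%N) + ln l%:R)).
  by rewrite mulr_ge0 ?addr_ge0// ltW.
move=> s; set w := omega M (expR s).
have w0 : 0 <= w by exact: omega_ge0.
set N0 := (l * C)%N.
have N0E : N0%:R = l%:R * C%:R :> R by rewrite natrM.
have N0R : 0 < N0%:R :> R by rewrite N0E mulr_gt0.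
have -> : C%:R * 2 * l%:R * w + C%:R * (d + ln (M 1%N) + ln l%:R) * l%:R
        = N0%:R * (w + d) + N0%:R * (w + ln (M 1%N) + ln l%:R).
  by rewrite N0E; ring.
set s' := s - b + ln l%:R.
have tE : l%:R * expR (s - b) = expR s' by rewrite /s' [RHS]expRD lnK ?posrE// mulrC.
rewrite tE.
(* Bounding [r s'] by [N0 s'] below requires [s' > 0]; otherwise the weight vanishes. *)
have [s'0|s'0] := leP s' 0.
  rewrite omega_le1; first by rewrite addr_ge0// mulr_ge0 ?addr_ge0// ltW.
  by rewrite -expR0 ler_expR.
have phi (p : nat) : p%:R * s - ln (M p) <= w.
  by rewrite -{1}[s]expRK omega_ge ?expR_gt0.
apply: omega_le => [|q]; first exact: expR_gt0.
rewrite expRK.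
have N0n : (0 < N0)%N by rewrite muln_gt0 l0.
rewrite {1}(divn_eq q N0); set p := (q %/ N0)%N; set r := (q %% N0)%N.
have aq : ln (M (N0 * p)%N) <= ln (M q).
  by rewrite LC_ln_nondecreasing// mulnC leq_divM.
have rs : r%:R * s' <= N0%:R * (w + ln (M 1%N) + ln l%:R).
  apply: (@le_trans _ _ (N0%:R * s')).
    by rewrite ler_pM2r// ler_nat ltnW// ltn_pmod.
  by rewrite ler_pM2l//; have := phi 1%N; rewrite /s'; lra.
suff main : N0%:R * p%:R * s' - ln (M (N0 * p)%N) <= N0%:R * (w + d).
  rewrite natrD mulrDl natrM [p%:R * _]mulrC; lra.
have [p0|p0] := posnP p.
  by rewrite p0 muln0 LC_ln0 mulr0 mul0r subrr mulr_ge0 ?addr_ge0.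
have pR : 0 < p%:R :> R by rewrite ltr0n.
have := Hd p p0; rewrite -/N0 natrM -(ler_pM2l (mulr_gt0 N0R pR)).
have -> : N0%:R * p%:R * (ln l%:R + ln (M p) / p%:R) =
    N0%:R * p%:R * ln l%:R + N0%:R * ln (M p).
  by field; rewrite gt_eqF.
have -> : N0%:R * p%:R * (b + d / p%:R + ln (M (N0 * p)%N) / (N0%:R * p%:R)) =
    N0%:R * p%:R * b + N0%:R * d + ln (M (N0 * p)%N).
  by field; rewrite !gt_eqF.
have : N0%:R * (p%:R * s - ln (M p)) <= N0%:R * w by rewrite ler_pM2l.
rewrite /s'; lra.
Qed.

Lemma log_growth_alpha1 (C : nat) (b : R) : (0 < C)%N ->
  0 <= b -> log_growth (fun l => l%:R) M C b -> alpha1 (omega M).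
Proof.
move=> C0 b0 H.
have B1 : 1 <= expR b by rewrite -expR0 ler_expR.
have C1 : 1 <= C%:R :> R by rewrite ler1n.
(* The factor [2 * expR b] pays for rounding [l * expR b >= 1] up to the integer [n], which is at
   most twice as large. *)
set c := C%:R * 2 * (2 * expR b).
have c1 : 1 <= c.
  by rewrite /c !mulr_ege1// ?ler1n.
exists c => // l l1; set n := (Num.truncn (l * expR b)).+1.
have B0 := expR_gt0 b.
have lB : 1 <= l * expR b by rewrite mulr_ege1.
have n1 : l * expR b <= n%:R by rewrite ltW// truncnS_gt.
have n2 : n%:R <= 2 * expR b * l.
  rewrite /n -natr1.
  by have := truncn_le (l * expR b); rewrite (le_trans ler01 lB); lra.
have [D D0 HD] := log_growth_omega_nat C0 b0 H (ltn0Sn _ : (0 < n)%N).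
exists (D * (2 * expR b) + 1).
  by rewrite lerDr mulr_ge0//; lra.
(* The substitution [t = expR s] misses [t = 0], treated first. *)
move=> t; rewrite le_eqVlt => /predU1P[<-|t0].
  have o0 : omega M 0 = 0 by rewrite /omega ltxx.
  by rewrite mulr0 o0 mulr0 add0r !(mulr_ge0, addr_ge0)// (le_trans ler01).
have := omega_ge0 t; set w := omega M t => w0.
have := HD (ln t); rewrite expRB lnK ?posrE// => h.
apply: le_trans (omega_nondecreasing _) (le_trans h _).
  rewrite mulrA ler_pdivlMr// mulrAC ler_wpM2r//; exact: ltW.
have : C%:R * 2 * w * n%:R <= C%:R * 2 * w * (2 * expR b * l).
  by rewrite ler_wpM2l// !mulr_ge0.
have : D * n%:R <= D * (2 * expR b * l) by rewrite ler_wpM2l.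
rewrite /c -/w; lra.
Qed.

End AssociatedWeight.

(** * Equivalence of (alpha1) with the three conditions *)

Theorem corollary5p2 (R : realType) (M : nat -> R) (hM : LC M) :
  let m := fun p : nat => M p / (p`!)%:R in
  [/\ alpha1 (omega M) <->
      (exists A B C : R, [/\ 1 <= A, 1 <= B, 1 <= C &
        forall lambda : R, 1 <= lambda ->
          exists2 D : R, 1 <= D &
            forall t : R, 0 <= t ->
              omega M (lambda * C * t)
                <= B * lambda * omega M (A * t) + D * lambda]),
      alpha1 (omega M) <->
      (exists (C : nat) (B : R), [/\ (0 < C)%N, 1 <= B &
        forall lambda : nat, (0 < lambda)%N ->
          exists2 D : R, 1 <= D &
            forall p : nat, (0 < p)%N ->
              lambda%:R * M p `^ (p%:R^-1)
                <= B * D `^ (p%:R^-1)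
                   * M (lambda * C * p)%N `^ ((lambda * C * p)%:R^-1)])
    & alpha1 (omega M) <->
      (exists (C : nat) (A : R), [/\ (0 < C)%N, 1 <= A &
        forall lambda : nat, (0 < lambda)%N ->
          exists2 D : R, 1 <= D &
            forall p : nat, (0 < p)%N ->
              m p `^ (p%:R^-1)
                <= A * D `^ (p%:R^-1)
                   * m (lambda * C * p)%N `^ ((lambda * C * p)%:R^-1)])].
Proof.
move=> m; have [M0 _ _ _] := hM.
have l0 (l : nat) : (0 < l)%N -> 0 < l%:R :> R by rewrite ltr0n.
have m0 p : 0 < m p by rewrite divr_gt0// ltr0n fact_gt0.
have alpha1P : alpha1 (omega M) <-> exists (C : nat) (b : R),
    [/\ (0 < C)%N, 0 <= b & log_growth (fun l => l%:R) M C b].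
  split=> [/(alpha1_log_growth hM)[C C0 H]|[C [b [C0 b0 H]]]].
    by exists C, 0.
  exact: (log_growth_alpha1 hM C0 b0 H).
split.
- split=> [[C C1 H]|[A [B [C [A1 B1 C1 H]]]]].
    exists 1, C, 1; split=> // l /H[D D1 HD]; exists D => // t /HD.
    by rewrite mulr1 mul1r.
  (* Apply (i) to [l A] and [t / A]: the right argument becomes [t], the left one [C l t >= l t],
     and both constants gain a factor [A]. *)
  exists (B * A); first by rewrite mulr_ege1.
  move=> l l1; have [|D D1 HD] := H (l * A); first by rewrite mulr_ege1.
  exists (D * A); first by rewrite mulr_ege1.
  have A0 : 0 < A := lt_le_trans ltr01 A1.
  move=> t t0; have /HD : 0 <= t / A by rewrite divr_ge0// ltW.
  rewrite [A * _]mulrC divfK ?gt_eqF// => h.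
  apply: le_trans (omega_nondecreasing hM _) (le_trans h _).
    have -> : l * A * C * (t / A) = C * (l * t) by field; rewrite gt_eqF.
    by rewrite ler_peMl// mulr_ge0// (le_trans ler01).
  lra.
- by rewrite alpha1P -(log_growthP l0 M0).
- transitivity (exists (C : nat) (b : R),
      [/\ (0 < C)%N, 0 <= b & log_growth (fun=> 1) m C b]).
    rewrite alpha1P; split=> -[C [b [C0 b0 H]]].
      exists C, (b + (ln C%:R + 1)); split=> //.
        by rewrite !addr_ge0// ln_ge0// ler1n.
      exact: log_growth_div_fact.
    exists C, (b + 1); split=> //; first by rewrite addr_ge0.
    exact: div_fact_log_growth.
  rewrite -(log_growthP (fun _ _ => ltr01) m0).
  split=> -[C [A [C0 A1 H]]]; exists C, A; split=> // l /H[D D1 HD];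
    exists D => // p /HD; rewrite mul1r; exact.
Qed.
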